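(* Let $n\mid(q+1)$, let $\delta\ge2$ be even, and let $b,s,m$ be positive integers with $\gcd(b,n)=1$. Let $t\in\{0,\dots,n-1\}$ and let $i_1<\dots<i_s$ be integers with $m-1+\delta\le i_1$, $i_s\le n-\delta$ and $i_{\ell+1}-i_\ell\ge\delta$ for $\ell=1,\dots,s-1$. Put $$A=\{\alpha^{t},\alpha^{t+b},\dots,\alpha^{t+(m-1)b},\alpha^{t+i_1b},\dots,\alpha^{t+i_sb}\},\qquad B=\{\alpha^{jb}: -\tfrac{\delta-2}{2}\le j\le\tfrac{\delta-2}{2}\}.$$ Suppose $\{j:\alpha^j\in AB\}$ is a union of $q$-cyclotomic cosets modulo $n$. Let $d_A^{\perp}$ be the minimum distance of the dual of the cyclic code of length $n$ over $\mathbb{F}_{q^2}$ with complete defining set $A$. Then $C_{AB}$ is a cyclic $(d_A^{\perp}-\delta+1,\delta)$-LRC of length $n$ over $\mathbb{F}_q$ with dimension $k=n-m+1-(s+1)(\delta-1)$. Moreover, if $\lceil k/r\rceil=s+1$ where $r=d_A^{\perp}-\delta+1$, then $C_{AB}$ is an optimal $(r,\delta)$-LRC with minimum distance $m+\delta-1$.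
   Context: Let $q$ be a prime power and $n\mid(q+1)$, so the multiplicative order of $q$ modulo $n$ divides $2$ and the set $R_n$ of all $n$-th roots of unity lies in $\mathbb{F}_{q^2}$; let $\alpha\in\mathbb{F}_{q^2}$ be a primitive $n$-th root of unity. For $A,B\subseteq R_n$, $AB=\{\beta\gamma:\beta\in A,\gamma\in B\}$. For $Z\subseteq R_n$, the cyclic code of length $n$ over $\mathbb{F}_{q^2}$ with complete defining set $Z$ is the ideal generated by $\prod_{\beta\in Z}(x-\beta)$ in $\mathbb{F}_{q^2}[x]/(x^n-1)$; if $\{j:\alpha^j\in Z\}$ is a union of $q$-cyclotomic cosets modulo $n$ (equivalently here, closed under $j\mapsto -j \bmod n$), this polynomial lies in $\mathbb{F}_q[x]$ and $C_Z$ denotes the cyclic code of length $n$ over $\mathbb{F}_q$ it generates in $\mathbb{F}_q[x]/(x^n-1)$ (dimension $n-|Z|$). Locality: for a linear code $C\subseteq\mathbb{F}_q^n$ and integers $r\ge1$, $\delta\ge2$, the $i$-th coordinate has $(r,\delta)$-locality if there is $S_i\subseteq\{1,\dots,n\}$ with $i\in S_i$, $|S_i|\le r+\delta-1$ such that the punctured code $C|_{S_i}$ has minimum distance at least $\delta$; $C$ is an $(r,\delta)$-LRC if every coordinate has $(r,\delta)$-locality. An $[n,k,d]$ $(r,\delta)$-LRC is optimal if $d=n-k-(\lceil k/r\rceil-1)(\delta-1)+1$ (always an upper bound on $d$). *)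

(* Defs.v *)
From HB Require Import structures.
From mathcomp Require Import all_boot all_order all_algebra all_field.
Set Implicit Arguments. Unset Strict Implicit. Unset Printing Implicit Defensive.
Import GRing.Theory.
Local Open Scope ring_scope.

Section Codes.
Variables (F : finFieldType) (n : nat).

Definition wt_on (S : {set 'I_n}) (c : 'rV[F]_n) : nat :=
  #|[set j in S | c 0 j != 0]|.

(* minimum distance of the punctured code C|_S: least weight of a nonzero
   vector of C|_S (convention: #|S|+1 if C|_S = 0) *)
Definition dmin_on (S : {set 'I_n}) (C : {set 'rV[F]_n}) : nat :=
  \big[minn/#|S|.+1]_(c in C | wt_on S c != 0%N) wt_on S c.

(* minimum distance of C (convention: n+1 for the zero code) *)
Definition min_dist (C : {set 'rV[F]_n}) : nat := dmin_on setT C.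

Definition dual_code (C : {set 'rV[F]_n}) : {set 'rV[F]_n} :=
  [set v : 'rV[F]_n | [forall c in C, \sum_(j < n) c 0 j * v 0 j == 0]].

Definition has_locality (C : {set 'rV[F]_n}) (r delta : nat) (i : 'I_n) : Prop :=
  exists S : {set 'I_n},
    [/\ i \in S, (#|S| <= r + delta - 1)%N & (delta <= dmin_on S C)%N].

Definition is_LRC (C : {set 'rV[F]_n}) (r delta : nat) : Prop :=
  [/\ (1 <= r)%N, (2 <= delta)%N & forall i : 'I_n, has_locality C r delta i].

Definition ceil_div (k r : nat) : nat := ((k + r.-1) %/ r)%N.

(* optimal [n,k,d] (r,delta)-LRC: k is the F-dimension, i.e. #|C| = #|F|^k *)
Definition optimal_LRC (C : {set 'rV[F]_n}) (r delta : nat) : Prop :=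
  is_LRC C r delta /\
  exists k : nat, #|C| = (#|F| ^ k)%N /\
    (min_dist C)%:Z = n%:Z - k%:Z - ((ceil_div k r)%:Z - 1) * (delta%:Z - 1) + 1.

End Codes.

Definition row_poly (R : nzRingType) (n : nat) (c : 'rV[R]_n) : {poly R} :=
  \poly_(j < n) (if insub j is Some j' then c 0 j' else 0).

Definition gen_poly (L : finFieldType) (Z : {set L}) : {poly L} :=
  \prod_(z in Z) ('X - z%:P).

Definition cyclic_code_ext (L : finFieldType) (n : nat) (Z : {set L}) : {set 'rV[L]_n} :=
  [set c : 'rV[L]_n | gen_poly Z %| row_poly c].

(* C_Z : cyclic code of length n over the subfield K (embedded by iota) generated
   by gen_poly Z (assumed to have coefficients in K) *)
Definition cyclic_code_sub (K L : finFieldType) (iota : {rmorphism K -> L}) (n : nat)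
  (Z : {set L}) : {set 'rV[K]_n} :=
  [set c : 'rV[K]_n | gen_poly Z %| map_poly iota (row_poly c)].

(* Main.v *)
Require Import Defs.
From HB Require Import structures.
From mathcomp Require Import all_boot all_order all_algebra all_field.
From mathcomp Require Import zify ring.
Import GRing.Theory.
Local Open Scope ring_scope.

Set Implicit Arguments.
Unset Strict Implicit.
Unset Printing Implicit Defensive.

(* If [c] lies in the code with defining set [AB] and [v] in the dual of the
   code with defining set [A], then the componentwise product [c v] has all the
   elements of [B] as zeros. The latter being [delta - 1] consecutive powers of
   [beta = alpha^b], the BCH bound says that [c] vanishes on the support of [v]
   or has at least [delta] nonzero entries there: the cyclic shifts of the
   support of a dual word of minimum weight are repair sets. The exponents of
   [AB] relative to [beta] form [s + 1] disjoint intervals in [0, n - 1), the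
   first one of length [m + delta - 2]; this yields the dimension and, by BCH,
   the lower bound on the distance. The upper bound is the Singleton-like bound,
   proved by joining [s] repair sets greedily and counting the codewords that
   vanish on their union. *)

(** * Minimum distance of a punctured code *)

Section MinimumDistance.

Variables (F : finFieldType) (n : nat).
Implicit Types (S T : {set 'I_n}) (C : {set 'rV[F]_n}) (c : 'rV[F]_n).

Lemma wt_on_neq0P S c : reflect (exists2 j, j \in S & c 0 j != 0) (wt_on S c != 0%N).
Proof.
rewrite -lt0n card_gt0; apply: (iffP (set0Pn _)) => [[j]|[j jS cj]].
  by rewrite inE => /andP[jS cj]; exists j.
by exists j; rewrite inE jS.
Qed.

Lemma wt_setT_neq0 c : (wt_on setT c != 0%N) = (c != 0).
Proof.
apply/wt_on_neq0P/idP => [[j _]|c0].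
  by apply: contraNneq => ->; rewrite mxE.
case: (pickP (fun j => c 0 j != 0)) => [j cj|z]; first by exists j.
by case/eqP: c0; apply/rowP => j; rewrite mxE; apply/eqP/negbFE/z.
Qed.

Lemma dmin_on_ge d S C : (d <= #|S|.+1)%N ->
  (forall c, c \in C -> wt_on S c != 0%N -> (d <= wt_on S c)%N) ->
  (d <= dmin_on S C)%N.
Proof.
move=> dS dC; rewrite /dmin_on.
apply: (big_ind (fun x => d <= x)%N) => //.
  by move=> x y dx dy; rewrite leq_min dx.
by move=> c /andP[]; exact: dC.
Qed.

Lemma dmin_on_le S C c : c \in C -> wt_on S c != 0%N ->
  (dmin_on S C <= wt_on S c)%N.
Proof.
move=> cC cS; rewrite /dmin_on.
have: c \in index_enum _ by rewrite mem_index_enum.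
elim: (index_enum _) => //= x l IHl; rewrite inE big_cons => /orP[/eqP<-|/IHl le].
  by rewrite cC cS geq_minl.
by case: ifP => // _; rewrite geq_min le orbT.
Qed.

(** The iterated minimum is either its default value [#|S|.+1] or the weight of some word; the
    hypothesis rules out the default. *)
Lemma dmin_on_attained S C : (dmin_on S C <= #|S|)%N ->
  exists c, [/\ c \in C, wt_on S c != 0%N & wt_on S c = dmin_on S C].
Proof.
rewrite /dmin_on; set d := \big[_/_]_(_ | _) _ => dS.
suff: d = #|S|.+1 \/ exists c, [/\ c \in C, wt_on S c != 0%N & wt_on S c = d].
  by case=> // eqd; move: dS; rewrite eqd ltnn.
rewrite /d {d dS}; apply: (big_ind (fun d => d = _ \/
    exists c, [/\ c \in C, wt_on S c != 0%N & wt_on S c = d])); first by left.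
  by move=> x y Hx Hy; rewrite minnE; case: (leqP x y) => xy;
     [rewrite (eqP xy) subn0 | rewrite subKn // ltnW].
by move=> c /andP[cC cS]; right; exists c.
Qed.

End MinimumDistance.

(** * The Singleton-like bound for codes with locality *)

Lemma exists_subset_card (T : finType) (A : {set T}) k : (k <= #|A|)%N ->
  exists2 X : {set T}, X \subset A & #|X| = k.
Proof.
rewrite -bin_gt0 -cards_draws card_gt0 => /set0Pn[X].
by rewrite inE => /andP[sXA /eqP]; exists X.
Qed.

Section SingletonBound.

Variables (F : finFieldType) (n : nat).
Implicit Types (S T : {set 'I_n}) (C : {set 'rV[F]_n}) (c : 'rV[F]_n).

(** The coordinates in [T] are kept rather than deleted, so that the subcodes for different [T] are
    compared by plain inclusion. *)
Definition shortened C T := [set c in C | [forall j in T, c 0 j == 0]].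

Lemma shortenedP C T c :
  reflect (c \in C /\ (forall j, j \in T -> c 0 j = 0)) (c \in shortened C T).
Proof.
rewrite inE; apply: (iffP andP) => -[cC]; first by move/forall_inP=> z; split=> // j /z/eqP.
by move=> z; split=> //; apply/forall_inP => j /z ->.
Qed.

(** Split the words by their value at [j]. Subtracting a fixed word of a fibre sends that fibre
    injectively to words vanishing at [j] as well, and there are at most [#|F|] fibres. *)
Lemma card_shortened1 C T j : {in C &, forall c c', c - c' \in C} ->
  (#|shortened C T| <= #|shortened C (j |: T)| * #|F|)%N.
Proof.
move=> CB; rewrite -sum1_card (partition_big (fun c => c 0 j) predT) //= mulnC.
rewrite -sum_nat_const; apply: leq_sum => x _; rewrite sum1_card.
case: (pickP [pred c in shortened C T | c 0 j == x]) => [c0|z]; last first.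
  by rewrite (eq_card0 z).
rewrite inE => /andP[/shortenedP[c0C c0T] /eqP c0j].
rewrite -(card_imset _ (addIr (- c0))); apply: subset_leq_card.
apply/subsetP => _ /imsetP[c /andP[/shortenedP[cC cT] /eqP cj] ->].
apply/shortenedP; split=> [|l]; first exact: CB.
by rewrite !inE !mxE => /orP[/eqP->|lT]; rewrite ?cj ?c0j ?cT ?c0T // subrr.
Qed.

Lemma card_shortenedU C T S : {in C &, forall c c', c - c' \in C} ->
  (#|shortened C T| <= #|shortened C (S :|: T)| * #|F| ^ #|S|)%N.
Proof.
move=> CB; move Dk: #|S| => k; elim: k => [|k IHk] in S T Dk *.
  by move/eqP: Dk; rewrite cards_eq0 => /eqP->; rewrite set0U muln1.
have [j jS] : exists j, j \in S by apply/set0Pn; rewrite -card_gt0 Dk.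
have Dk' : #|S :\ j| = k by move: (cardsD1 j S); rewrite jS Dk add1n => -[].
apply: leq_trans (card_shortened1 T j CB) _.
rewrite expnSr mulnA leq_mul2r; apply/orP; right.
by apply: leq_trans (IHk _ _ Dk') _; rewrite setUCA setUA setD1K.
Qed.

Lemma shortened_neq0 C T : (1 < #|shortened C T|)%N ->
  exists c, [/\ c \in C, c != 0 & forall j, j \in T -> c 0 j = 0].
Proof.
move=> gt1; have [c] : exists c, c \in shortened C T :\ 0.
  by apply/set0Pn; rewrite -card_gt0; move: gt1; rewrite (cardsD1 0); case: (0 \in _) => //; exact: ltnW.
by rewrite in_setD1 => /andP[c0 /shortenedP[cC cT]]; exists c.
Qed.

(** Counting replaces linear algebra here: the first hypothesis stands for a code of dimension [k]
    with rank at most [rho] on [T]. A single remaining word would force [k <= rho]. *)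
Lemma card_shortened_gt1 C T k rho :
  (#|F| ^ k <= #|shortened C T| * #|F| ^ rho)%N -> (rho < k)%N ->
  (1 < #|shortened C T|)%N.
Proof.
move=> rank lt_rho; rewrite ltnNge; apply/negP => le1.
have: (#|F| ^ k <= #|F| ^ rho)%N.
  by apply: leq_trans rank _; rewrite -[leqRHS]mul1n leq_mul2r le1 orbT.
by rewrite leq_exp2l ?finRing_gt1 //; lia.
Qed.

(* [rho] bounds the rank of [C] on [T] from above; each repair set that is not
   yet determined by [T] contributes [delta - 1] redundant coordinates. *)
Lemma repair_sets_union C r delta k l : {in C &, forall c c', c - c' \in C} ->
  is_LRC C r delta -> #|C| = (#|F| ^ k)%N -> (l * r < k + r)%N ->
  exists T rho, [/\ (#|F| ^ k <= #|shortened C T| * #|F| ^ rho)%N,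
    (rho <= l * r)%N & (rho + l * (delta - 1) <= #|T|)%N].
Proof.
move=> CB [r_gt0 delta_gt1 loc] cardC; elim: l => [|l IHl] lr.
  exists set0, 0%N; split; rewrite ?muln1 //.
  rewrite -cardC; apply/subset_leq_card/subsetP => c cC.
  by apply/shortenedP; split=> // j; rewrite inE.
have [|T [rho [rank le_rho sizeT]]] := IHl; first by lia.
(* The hypothesis gives [l * r < k], so [T] does not determine the code yet. A nonzero word
   vanishing on [T] yields a coordinate [j] whose repair set [S] sticks out of [T] by at least
   [delta] elements. *)
have [c [cC c0 cT]] : exists c, [/\ c \in C, c != 0 & forall j, j \in T -> c 0 j = 0].
  by apply/shortened_neq0/(card_shortened_gt1 rank); lia.
have [j _ cj] : exists2 j, j \in setT & c 0 j != 0.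
  by apply/wt_on_neq0P; rewrite wt_setT_neq0.
have [S [jS sizeS dS]] := loc j.
have wt_sub (U : {set 'I_n}) c' : (forall x, x \in S -> x \notin U -> c' 0 x = 0) ->
    (wt_on S c' <= #|U|)%N.
  move=> z; apply/subset_leq_card/subsetP => x; rewrite inE => /andP[xS].
  by apply: contraNT => /(z _ xS) ->.
have dle c' : c' \in C -> wt_on S c' != 0%N -> (delta <= wt_on S c')%N.
  by move=> c'C c'S; apply: leq_trans dS (dmin_on_le c'C c'S).
have geS : (delta <= #|S :\: T|)%N.
  apply: leq_trans (dle c cC _) _; first by apply/wt_on_neq0P; exists j.
  by apply: wt_sub => x xS; rewrite inE xS andbT negbK => /cT.
(* The [delta - 1] coordinates of [X] will be determined by the others in [S]; only the remaining
   ones, [Y], are charged to the rank, and there are at most [r] of them. *)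
have [X sXS cardX] : exists2 X : {set 'I_n}, X \subset S :\: T & #|X| = (delta - 1)%N.
  by apply: exists_subset_card; lia.
pose Y := (S :\: T) :\: X.
have cardY : #|Y| = (#|S :\: T| - (delta - 1))%N by rewrite [LHS]cardsD (setIidPr sXS) cardX.
have leST : (#|S :\: T| <= #|S|)%N by apply/subset_leq_card/subsetDl.
exists (S :|: T), (rho + #|Y|)%N; split; first 1 last.
- by move: cardY sizeS; rewrite mulSn; lia.
- have -> : #|S :|: T| = (#|S :\: T| + #|T|)%N.
    by rewrite -cardsUI setDE -setIA [~: T :&: _]setIC setICr setI0 cards0 addn0
      setUIl [~: T :|: T]setUC setUCr setIT.
  by rewrite mulSn; lia.
apply: leq_trans rank _; rewrite expnD mulnCA [leqLHS]mulnC leq_mul2l; apply/orP; right.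
apply: leq_trans (card_shortenedU T Y CB) _; rewrite leq_mul2r; apply/orP; right.
(* A word vanishing on [Y] and [T] is supported within [S] on [X] only. Its weight on [S] is then
   below [delta], hence zero. *)
apply/subset_leq_card/subsetP => c' /shortenedP[c'C c'YT].
apply/shortenedP; split=> // x; have := c'YT x; rewrite inE => c'x.
have [xT|xT] := boolP (x \in T); first by rewrite c'x // xT orbT.
rewrite inE (negbTE xT) orbF => xS; apply/eqP; apply: contraTT isT => c'x0.
have: (delta <= wt_on S c')%N by apply: dle => //; apply/wt_on_neq0P; exists x.
suff: (wt_on S c' <= delta - 1)%N by lia.
rewrite -cardX; apply: wt_sub => y yS yX; apply: c'YT.
by rewrite !inE yX yS andbT; case: (y \in T).
Qed.

Lemma LRC_singleton_bound C r delta k l : {in C &, forall c c', c - c' \in C} ->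
  is_LRC C r delta -> #|C| = (#|F| ^ k)%N -> (l * r < k)%N ->
  (min_dist C + k + l * (delta - 1) <= n.+1)%N.
Proof.
move=> CB lrc cardC lr.
have [|T [rho [rank le_rho sizeT]]] := @repair_sets_union C r delta k l CB lrc cardC; first by lia.
(* Enlarge [T] until the rank bound reaches [k - 1]. If the complement of [T] runs out first, the
   word [c] below would vanish everywhere, a contradiction. *)
have [|Y sYT cardY] := @exists_subset_card _ (~: T) (minn (k.-1 - rho) #|~: T|).
  exact: geq_minr.
have cardYT : #|Y :|: T| = (#|Y| + #|T|)%N.
  have /eqP YT0 : Y :&: T == set0 by rewrite setI_eq0 disjoints_subset.
  by rewrite -cardsUI YT0 cards0 addn0.
have [c [cC c0 cYT]] : exists c, [/\ c \in C, c != 0 & forall j, j \in Y :|: T -> c 0 j = 0].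
  apply/shortened_neq0/(@card_shortened_gt1 C (Y :|: T) k (rho + #|Y|)); last by lia.
  apply: leq_trans rank _; rewrite expnD mulnCA [leqLHS]mulnC leq_mul2l.
  by rewrite card_shortenedU ?orbT.
have wc : wt_on setT c != 0%N by rewrite wt_setT_neq0.
have wle : (wt_on setT c <= n - #|Y :|: T|)%N.
  have -> : (n - #|Y :|: T|)%N = #|~: (Y :|: T)|.
    by have := cardsC (Y :|: T); rewrite card_ord; lia.
  apply/subset_leq_card/subsetP => j; rewrite in_setC inE => /andP[_].
  by apply: contraNN => /cYT ->.
have := dmin_on_le cC wc; rewrite -/(min_dist C).
have := cardsC T; rewrite card_ord.
by move: wc wle; rewrite cardYT cardY; lia.
Qed.

End SingletonBound.

(** * The BCH bound and codes described by their zeros *)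

(* The polynomial vanishing at all points of the support but one separates that
   coordinate; its degree is below [D] if the support has at most [D] points. *)
Lemma BCH_bound (F : finFieldType) n (gamma a : F) D (c : 'rV[F]_n) :
  injective (fun j : 'I_n => gamma ^+ j) -> a != 0 ->
  (forall w, (w < D)%N -> \sum_(j < n) c 0 j * (a * gamma ^+ w) ^+ j = 0) ->
  c != 0 -> (D < wt_on setT c)%N.
Proof.
move=> inj_gamma a0 roots c0; rewrite ltnNge; apply/negP => wtD.
have [j0 _ cj0] : exists2 j, j \in setT & c 0 j != 0.
  by apply/wt_on_neq0P; rewrite wt_setT_neq0.
(* The [D] checks are the monomials of degree below [D] evaluated at the points [gamma ^+ j]; their
   linear combinations give a check for every such polynomial [g]. *)
have ev (g : {poly F}) : (size g <= D)%N ->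
    \sum_(j < n) c 0 j * (a ^+ j * g.[gamma ^+ j]) = 0.
  move=> sg; under eq_bigr => j _ do rewrite horner_coef !mulr_sumr.
  rewrite exchange_big big1 //= => w _.
  transitivity (g`_w * \sum_(j < n) c 0 j * (a * gamma ^+ w) ^+ j); last first.
    by rewrite roots ?mulr0 // (leq_trans (ltn_ord w) sg).
  rewrite mulr_sumr; apply: eq_bigr => j _.
  by rewrite exprMn -!exprM [(j * w)%N]mulnC !mulrA [_ * g`_w]mulrC !mulrA.
set S := [set j in setT | c 0 j != 0] in wtD *.
have Sj0 : j0 \in S by rewrite !inE.
pose g := \prod_(j in S :\ j0) ('X - (gamma ^+ j)%:P).
have sg : (size g <= D)%N.
  rewrite /g -big_enum size_prod_XsubC -cardE.
  by move: wtD; rewrite /wt_on -/S (cardsD1 j0 S) Sj0.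
have := ev g sg; rewrite (bigD1 j0) //= big1 ?addr0 => [|j jj0].
  apply/eqP; rewrite !mulf_neq0 ?expf_neq0 //.
  rewrite /g horner_prod; apply/prodf_neq0 => j; rewrite !inE => /andP[jj0 _].
  by rewrite !hornerE subr_eq0; apply: contraNneq jj0 => /inj_gamma ->.
have [->|cj] := eqVneq (c 0 j) 0; first by rewrite mul0r.
suff -> : g.[gamma ^+ j] = 0 by rewrite !mulr0.
apply/eqP; rewrite /g horner_prod; apply/prodf_eq0; exists j; first by rewrite !inE jj0.
by rewrite !hornerE subrr.
Qed.

Lemma gen_poly_dvdP (L : finFieldType) (Z : {set L}) (p : {poly L}) :
  reflect {in Z, forall z, p.[z] = 0} (gen_poly Z %| p).
Proof.
rewrite /gen_poly -big_enum; apply: (iffP idP) => [dv z Zz | rt].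
  have /rootP gz : root (\prod_(x <- enum Z) ('X - x%:P)) z.
    by rewrite root_prod_XsubC mem_enum.
  by have /dvdpP[r ->] := dv; rewrite hornerM gz mulr0.
apply: uniq_roots_dvdp; last by rewrite uniq_rootsE enum_uniq.
by apply/allP => z; rewrite mem_enum => /rt/rootP.
Qed.

Lemma horner_row_poly (R : nzRingType) n (c : 'rV[R]_n) x :
  (row_poly c).[x] = \sum_(j < n) c 0 j * x ^+ j.
Proof. by rewrite horner_poly; apply: eq_bigr => j _; rewrite valK. Qed.

Lemma cyclic_code_extP (L : finFieldType) n (Z : {set L}) (c : 'rV[L]_n) :
  reflect {in Z, forall z, \sum_(j < n) c 0 j * z ^+ j = 0} (c \in cyclic_code_ext n Z).
Proof.
rewrite inE; apply: (iffP (gen_poly_dvdP _ _)) => H z /H; by rewrite horner_row_poly.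
Qed.

(** The code over [K] is a subfield subcode, so its zeros can be handled in [L]. *)
Lemma cyclic_code_subE (K L : finFieldType) (iota : {rmorphism K -> L}) n
    (Z : {set L}) (c : 'rV[K]_n) :
  (c \in cyclic_code_sub iota n Z) = (map_mx iota c \in cyclic_code_ext n Z).
Proof.
rewrite !inE; congr (_ %| _); apply/polyP => j.
rewrite coef_map !coef_poly; case: (j < n)%N; last exact: rmorph0.
by case: insub => [j'|]; [rewrite mxE | exact: rmorph0].
Qed.

Lemma dual_codeP (F : finFieldType) n (C : {set 'rV[F]_n}) (v : 'rV[F]_n) :
  reflect {in C, forall c : 'rV[F]_n, \sum_(j < n) c 0 j * v 0 j = 0} (v \in dual_code C).
Proof. by rewrite inE; apply: (iffP forall_inP) => H c /H/eqP. Qed.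

Lemma wt_on_map (K L : finFieldType) (iota : {rmorphism K -> L}) n S (c : 'rV[K]_n) :
  wt_on S (map_mx iota c) = wt_on S c.
Proof. by apply: eq_card => j; rewrite !inE mxE fmorph_eq0. Qed.

Lemma prim_root_inj (F : fieldType) n (z : F) : n.-primitive_root z ->
  injective (fun j : 'I_n => z ^+ j).
Proof.
move=> pz j j' /eqP; rewrite (eq_prim_root_expr pz) !modn_small //.
by move/eqP/val_inj.
Qed.

Lemma map_gen_poly (L : finFieldType) (phi : {rmorphism L -> L}) (Z : {set L}) :
  map_poly phi (gen_poly Z) = gen_poly [set phi z | z in Z].
Proof.
rewrite /gen_poly rmorph_prod big_imset /=; last by move=> x y _ _ /fmorph_inj.
by apply: eq_bigr => z _; rewrite rmorphB /= map_polyX map_polyC.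
Qed.

(** * Descent of the generator polynomial to the subfield, and the dimension *)

Section Descent.

Variables (K L : finFieldType) (iota : {rmorphism K -> L}).
Let q := #|K|.

(** Makes the map raising to the power [q] additive on [L]. *)
Lemma pnat_card_subfield : [pchar L].-nat q.
Proof.
have [p pr_p pK] := finPcharP K.
have pL := rmorph_pchar iota pK.
rewrite (eq_pnat _ (pcharf_eq pL)) /q (card_pprimeChar pK) pnatX pnat_id //.
Qed.

(** ['X^q - 'X] already splits over [K] into the factors ['X - y%:P], so its roots in [L] are images
    of elements of [K]. *)
Lemma fixed_qpow_subfield (x : L) : x ^+ q = x -> exists y, x = iota y.
Proof.
move=> xq; have : root (map_poly iota ('X^q - 'X)) x.
  by rewrite rmorphB /= map_polyXn map_polyX rootE !hornerE xq subrr.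
rewrite finField_genPoly rmorph_prod /=.
under eq_bigr => y _ do rewrite rmorphB /= map_polyX map_polyC.
rewrite rootE horner_prod => /prodf_eq0[y _].
by rewrite !hornerE subr_eq0 => /eqP ->; exists y.
Qed.

(** The [q]-power Frobenius is injective and thus permutes [Z]. It therefore fixes each coefficient
    of the generator, and fixed elements come from [K]. *)
Lemma gen_poly_descent (Z : {set L}) : {in Z, forall z, z ^+ q \in Z} ->
  exists g : {poly K}, map_poly iota g = gen_poly Z.
Proof.
move=> Zq; pose phi0 (x : L) := x ^+ q.
have phiD : nmod_morphism phi0.
  split=> [|x y]; first by rewrite /phi0 expr0n eqn0Ngt ltnW ?finRing_gt1.
  by rewrite /phi0 exprDn_pchar //; exact: pnat_card_subfield.
have phiM : monoid_morphism phi0 by split=> [|x y]; rewrite /phi0 ?expr1n ?exprMn.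
pose phi : {rmorphism L -> L} := HB.pack phi0
  (GRing.isNmodMorphism.Build L L phi0 phiD) (GRing.isMonoidMorphism.Build L L phi0 phiM).
have phiZ : [set phi z | z in Z] = Z.
  apply/eqP; rewrite eqEcard card_imset ?leqnn ?andbT; last exact: fmorph_inj.
  by apply/subsetP => _ /imsetP[z Zz ->]; exact: Zq.
have fixg : map_poly phi (gen_poly Z) = gen_poly Z.
  by rewrite map_gen_poly phiZ.
(* A preimage under [iota], with the irrelevant value 0 outside its image. *)
pose h x := odflt 0 [pick y | iota y == x].
have hK x : x ^+ q = x -> iota (h x) = x.
  case/fixed_qpow_subfield => y ->; rewrite /h; case: pickP => [z /eqP //|/(_ y)].
  by rewrite eqxx.
exists (\poly_(j < size (gen_poly Z)) h (gen_poly Z)`_j); apply/polyP => j.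
rewrite coef_map coef_poly; case: ltnP => jg; last first.
  by rewrite nth_default //; exact: rmorph0.
by apply: hK; rewrite -[in RHS]fixg coef_map.
Qed.

(** Multiplication by the descended generator [g], of degree [#|Z|], is a bijection from the
    polynomials of degree below [n - #|Z|] onto the code. *)
Lemma card_cyclic_code_sub n (Z : {set L}) : {in Z, forall z, z ^+ q \in Z} ->
  (#|Z| <= n)%N -> #|cyclic_code_sub iota n Z| = (q ^ (n - #|Z|))%N.
Proof.
move=> Zq Zn; have [g gE] := gen_poly_descent Zq.
have sg : size g = #|Z|.+1.
  by rewrite -(size_map_poly iota) gE /gen_poly -big_enum size_prod_XsubC -cardE.
have g0 : g != 0 by rewrite -size_poly_eq0 sg.
pose f (u : 'rV[K]_(n - #|Z|)) : 'rV[K]_n := poly_rV (rVpoly u * g).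
have fK u : rVpoly (f u) = rVpoly u * g.
  apply: poly_rV_K; apply: leq_trans (size_polyMleq _ _) _.
  have su : (size (rVpoly u) <= n - #|Z|)%N by exact: size_poly.
  by rewrite sg addnS /=; apply: leq_trans (leq_add su (leqnn _)) _; rewrite subnK.
have inj_f : injective f.
  move=> u v /(congr1 rVpoly); rewrite !fK => /(mulIf g0)/(congr1 (@poly_rV _ (n - #|Z|))).
  by rewrite !rVpolyK.
have -> : cyclic_code_sub iota n Z = [set f u | u in setT].
  apply/setP => c; rewrite inE -gE dvdp_map -[row_poly c]/(rVpoly c).
  apply/idP/imsetP => [/dvdpP[p cE]|[u _ ->]]; last by rewrite fK dvdp_mull.
  exists (poly_rV p) => //; apply: (can_inj rVpolyK).
  rewrite fK poly_rV_K -?cE //.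
  have [->|p0] := eqVneq p 0; first by rewrite size_poly0.
  have : (size (rVpoly c) <= n)%N by exact: size_poly.
  by rewrite cE size_mul // sg addnS addnC leq_subRL.
by rewrite card_imset // cardsT card_mx mul1n.
Qed.

End Descent.

(** * Dual words, cyclic shifts and blocks of exponents *)

(** Twisting [c] by the powers of [y] turns the zeros [a * y] into zeros [a]. The twisted word lies
    in the code with defining set [A], hence is orthogonal to [v]. *)
Lemma dual_code_diag (L : finFieldType) n (A B : {set L}) (c v : 'rV[L]_n) y :
  c \in cyclic_code_ext n [set a * b | a in A, b in B] ->
  v \in dual_code (cyclic_code_ext n A) -> y \in B ->
  \sum_(j < n) c 0 j * v 0 j * y ^+ j = 0.
Proof.
move=> /cyclic_code_extP cAB /dual_codeP vA yB.
rewrite -[RHS](vA (\row_j (c 0 j * y ^+ j))).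
  by apply: eq_bigr => j _; rewrite mxE mulrAC.
apply/cyclic_code_extP => a aA; rewrite -[RHS](cAB (a * y)).
  by apply: eq_bigr => j _; rewrite mxE exprMn mulrAC mulrA.
by apply/imset2P; exists a y.
Qed.

(** Shifting a codeword backwards multiplies its value at [a] by a power of [a], because [a] is a
    root of unity of order dividing the length. The length is a successor so that indices add
    cyclically. *)
Lemma dual_code_shift (L : finFieldType) n (A : {set L}) (v : 'rV[L]_n.+1) h :
  {in A, forall a, a ^+ n.+1 = 1} ->
  v \in dual_code (cyclic_code_ext n.+1 A) ->
  (\row_j v 0 (j + h)) \in dual_code (cyclic_code_ext n.+1 A).
Proof.
move=> A1 /dual_codeP vA; apply/dual_codeP => c /cyclic_code_extP cA.
rewrite (reindex_inj (addIr (- h))) /=.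
under eq_bigr => j _ do rewrite mxE subrK.
rewrite -[RHS](vA (\row_j c 0 (j - h))).
  by apply: eq_bigr => j _; rewrite mxE.
apply/cyclic_code_extP => a aA.
rewrite (reindex_inj (addIr h)) /= -[RHS](mulr0 (a ^+ h)) -[in RHS](cA a aA) mulr_sumr.
apply: eq_bigr => j _; rewrite mxE addrK /= expr_mod ?A1 // exprD.
by rewrite mulrA mulrC.
Qed.

(** Induction on [s]: all earlier entries lie below the end of the previous block, hence below the
    start of the next. It is used for the exponents occurring in [AB]. *)
Lemma uniq_blocks N d s (i : nat -> nat) : (0 < s)%N -> (N <= i 0%N)%N ->
  (forall l, (l.+1 < s)%N -> (i l + d <= i l.+1)%N) ->
  let W := iota 0 N ++ flatten [seq iota (i l) d | l <- iota 0 s] in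
  [/\ uniq W, size W = (N + s * d)%N & {in W, forall w, (w < i s.-1 + d)%N}].
Proof.
case: s => // s _ Ni; elim: s => [|s IHs] gap W.
  rewrite /W /= cats0 size_cat !size_iota mul1n; split=> // [|w].
    rewrite cat_uniq !iota_uniq andbT; apply/hasPn => w.
    by rewrite !mem_iota; lia.
  by rewrite mem_cat !mem_iota; lia.
have [|uW0 sW0 W0lt] := IHs; first by move=> l ls; apply: gap; lia.
have gap_s := gap s (leqnn _).
have WE : W = (iota 0 N ++ flatten [seq iota (i l) d | l <- iota 0 s.+1]) ++ iota (i s.+1) d.
  by rewrite /W -[s.+2]addn1 iotaD map_cat flatten_cat /= cats0 catA.
rewrite WE cat_uniq size_cat uW0 sW0 size_iota iota_uniq andbT; split.
- apply/hasPn => w; rewrite mem_iota => /andP[iw _].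
  by apply: contraTN iw => /W0lt /=; lia.
- by rewrite [in RHS]mulSn; lia.
by move=> w; rewrite mem_cat mem_iota => /orP[/W0lt|] /=; lia.
Qed.

Lemma sum_unity_root (F : fieldType) n (z : F) : z ^+ n = 1 -> z != 1 ->
  \sum_(j < n) z ^+ j = 0.
Proof.
move=> zn z1; apply/eqP; have /eqP := subrX1 z n.
by rewrite zn subrr eq_sym mulf_eq0 subr_eq0 (negPf z1).
Qed.

Lemma wt_setT_le (F : finFieldType) n (c : 'rV[F]_n) : (wt_on setT c <= n)%N.
Proof. by rewrite -[leqRHS]card_ord max_card. Qed.

Lemma wt_shift (F : finFieldType) n (v : 'rV[F]_n.+1) h :
  wt_on setT (\row_j v 0 (j + h)) = wt_on setT v.
Proof.
rewrite /wt_on -[RHS](card_imset _ (addIr (- h))); apply: eq_card => j.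
rewrite !inE mxE; apply/idP/imsetP => [vj|[l]].
  by exists (j + h); rewrite ?inE ?addrK.
by rewrite !inE => vl ->; rewrite subrK.
Qed.

(** * Locality of the code with defining set [AB] *)

Section CyclicProduct.

Variables (K L : finFieldType) (iota : {rmorphism K -> L}) (n : nat).
Variables (A B : {set L}) (gamma : L).
Hypothesis prim_gamma : n.-primitive_root gamma.
Hypothesis A_unity : {in A, forall x, x ^+ n = 1}.

Local Notation AB := [set x * y | x in A, y in B].
Local Notation dA := (min_dist (dual_code (cyclic_code_ext n A))).

(* The vectors [(a gamma^w)^j]_j belong to the code with defining set [A], so
   the BCH bound applies to its dual. *)
Lemma dual_code_BCH a D : a != 0 -> (D <= n)%N ->
  (forall w x, (w < D)%N -> x \in A ->
     (x * (a * gamma ^+ w)) ^+ n = 1 /\ x * (a * gamma ^+ w) != 1) ->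
  (D < dA)%N.
Proof.
move=> a0 Dn Aw; apply: dmin_on_ge; first by rewrite cardsT card_ord.
move=> v /dual_codeP vA; rewrite wt_setT_neq0 => v0.
apply: BCH_bound (prim_root_inj prim_gamma) a0 _ v0 => w wD.
rewrite -[RHS](vA (\row_j (a * gamma ^+ w) ^+ j)).
  by apply: eq_bigr => j _; rewrite mxE mulrC.
apply/cyclic_code_extP => x xA; have [xn x1] := Aw w x wD xA.
rewrite -[RHS](sum_unity_root xn x1); apply: eq_bigr => j _.
by rewrite mxE [in RHS]exprMn mulrC.
Qed.

(** An element [x] of [A] gives the nonzero dual word of powers of [x], so the distance is not the
    conventional value of the zero code. *)
Lemma dual_dist_attained : A != set0 ->
  exists v, [/\ v \in dual_code (cyclic_code_ext n A), v != 0 & wt_on setT v = dA].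
Proof.
case/set0Pn => x xA; have n_gt0 := prim_order_gt0 prim_gamma.
have [|v [vA v0 vd]] := @dmin_on_attained _ n setT (dual_code (cyclic_code_ext n A)).
  pose u : 'rV[L]_n := \row_j x ^+ j.
  have uA : u \in dual_code (cyclic_code_ext n A).
    apply/dual_codeP => c /cyclic_code_extP/(_ x xA) cx.
    by rewrite -[RHS]cx; apply: eq_bigr => j _; rewrite mxE.
  have u0 : wt_on setT u != 0%N.
    apply/wt_on_neq0P; exists (Ordinal n_gt0); rewrite ?inE //.
    by rewrite mxE expr0 oner_neq0.
  by apply: leq_trans (dmin_on_le uA u0) _; rewrite cardsT card_ord wt_setT_le.
by exists v; rewrite -wt_setT_neq0.
Qed.

(** The weight of [c] on the support of [v] is the full weight of the product [cv], to which the BCH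
    bound applies. The lower bound on the weight of [v] handles the default value of [dmin_on]. *)
Lemma product_code_dist_on a D (v : 'rV[L]_n) :
  a != 0 -> (forall w, (w < D)%N -> a * gamma ^+ w \in B) ->
  v \in dual_code (cyclic_code_ext n A) -> (D <= wt_on setT v)%N ->
  (D < dmin_on [set j in [set: 'I_n] | v 0 j != 0]%R (cyclic_code_sub iota n AB))%N.
Proof.
move=> a0 aB vA Dv; apply: dmin_on_ge => // c; rewrite cyclic_code_subE => cAB.
pose cv : 'rV[L]_n := \row_j (iota (c 0 j) * v 0 j).
have -> : wt_on [set j in [set: 'I_n] | v 0 j != 0] c = wt_on setT cv.
  by apply: eq_card => j; rewrite !inE mxE mulf_eq0 fmorph_eq0 negb_or andbC.
rewrite wt_setT_neq0 => cv0.
apply: BCH_bound (prim_root_inj prim_gamma) a0 _ cv0 => w wD.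
rewrite -[RHS](dual_code_diag cAB vA (aB w wD)).
by apply: eq_bigr => j _; rewrite !mxE.
Qed.

Lemma product_code_LRC a D : a != 0 -> (0 < D < dA)%N -> A != set0 ->
  (forall w, (w < D)%N -> a * gamma ^+ w \in B) ->
  is_LRC (cyclic_code_sub iota n AB) (dA - D.+1 + 1) D.+1.
Proof.
move=> a0 /andP[D_gt0 DdA] A0 aB; split; [by rewrite addn1 | by [] | move=> j].
have [v [vA v0 vd]] := dual_dist_attained A0.
have [h _ vh] : exists2 h, h \in setT & v 0 h != 0.
  by apply/wt_on_neq0P; rewrite wt_setT_neq0.
suff [u [uA uj ud]] : exists u, [/\ u \in dual_code (cyclic_code_ext n A),
    u 0 j != 0 & wt_on setT u = dA].
  exists [set l in [set: 'I_n] | u 0 l != 0]; split; first by rewrite !inE.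
    by rewrite -/(wt_on setT u) ud; lia.
  by apply: product_code_dist_on aB uA _ => //; rewrite ud ltnW.
(* Shift the minimum weight word [v] so that the position [h] of its support moves to [j]. *)
case: n A_unity j v vA v0 vd h vh => [? []//|n'] A1 j v vA v0 vd h vh.
exists (\row_l v 0 (l + (h - j))); split; first exact: dual_code_shift.
  by rewrite mxE addrC subrK.
by rewrite wt_shift.
Qed.

End CyclicProduct.

(** * Parameters and optimality of the code *)

Lemma cyclic_code_sub_BCH (K L : finFieldType) (iota : {rmorphism K -> L}) n
    (Z : {set L}) (gamma a : L) D :
  n.-primitive_root gamma -> a != 0 -> (D <= n)%N ->
  (forall w, (w < D)%N -> a * gamma ^+ w \in Z) ->
  (D < min_dist (cyclic_code_sub iota n Z))%N.
Proof.
move=> prim_gamma a0 Dn aZ; apply: dmin_on_ge; first by rewrite cardsT card_ord.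
move=> c; rewrite cyclic_code_subE -(wt_on_map iota) wt_setT_neq0.
move=> /cyclic_code_extP cZ c0.
by apply: BCH_bound (prim_root_inj prim_gamma) a0 _ c0 => w /aZ/cZ.
Qed.

Lemma cyclic_code_subB (K L : finFieldType) (iota : {rmorphism K -> L}) n (Z : {set L}) :
  {in cyclic_code_sub iota n Z &, forall c c', c - c' \in cyclic_code_sub iota n Z}.
Proof.
move=> c c'; rewrite !cyclic_code_subE => /cyclic_code_extP cZ /cyclic_code_extP c'Z.
apply/cyclic_code_extP => z zZ.
transitivity (\sum_(j < n) (map_mx iota c) 0 j * z ^+ j -
              \sum_(j < n) (map_mx iota c') 0 j * z ^+ j); last by rewrite cZ ?c'Z ?subrr.
rewrite -sumrB.
by apply: eq_bigr => j _; rewrite !mxE rmorphB mulrBl.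
Qed.

Theorem theorem5p1 (K L : finFieldType) (iota : {rmorphism K -> L}) (q n : nat)
  (alpha : L) (delta b s m t : nat) (i : nat -> nat) :
  #|K| = q -> #|L| = (q ^ 2)%N -> (n %| q.+1)%N -> n.-primitive_root alpha ->
  (2 <= delta)%N -> ~~ odd delta ->
  (0 < b)%N -> (0 < s)%N -> (0 < m)%N -> coprime b n -> (t < n)%N ->
  (m.-1 + delta <= i 0%N)%N -> (i s.-1 <= n - delta)%N ->
  (forall l : nat, (l.+1 < s)%N -> (i l + delta <= i l.+1)%N) ->
  let A := [set alpha ^+ (t + j * b) | j : 'I_m]
           :|: [set alpha ^+ (t + i l * b) | l : 'I_s] in
  let B := [set alpha ^ (((j : nat)%:Z - ((delta - 2)./2)%:Z) * b%:Z) | j : 'I_(delta.-1)] in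
  let AB := [set x * y | x in A, y in B] in
  (forall j : nat, alpha ^+ j \in AB -> alpha ^+ (j * q) \in AB) ->
  let dA := min_dist (dual_code (cyclic_code_ext n A)) in
  let r := (dA - delta + 1)%N in
  let k := (n - m + 1 - s.+1 * (delta - 1))%N in
  let C := cyclic_code_sub iota n AB in
  [/\ (delta <= dA)%N, is_LRC C r delta, #|C| = (q ^ k)%N &
      (ceil_div k r = s.+1 -> optimal_LRC C r delta /\ min_dist C = (m + delta - 1)%N)].
Proof.
move=> cardK _ _ prim_alpha delta_gt1 _ _ s_gt0 m_gt0 cop_b _ i0_ge is_le gap A B AB AB_q.
move=> dA r k C.
pose beta := alpha ^+ b; set e := (delta - 2)./2 in B AB AB_q C *.
have prim_beta : n.-primitive_root beta by rewrite prim_root_exp_coprime.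
have n_gt0 := prim_order_gt0 prim_alpha.
have alpha0 : alpha != 0 by rewrite (prim_root_eq0 prim_alpha) -lt0n.
have beta0 : beta != 0 by rewrite expf_neq0.
(* The exponents of [beta] in [A] once [alpha ^+ t] is factored out. *)
pose J u := (u < m)%N \/ exists2 l, (l < s)%N & u = i l.
have AP x : reflect (exists2 u, J u & x = alpha ^+ t * beta ^+ u) (x \in A).
  have E u : alpha ^+ (t + u * b) = alpha ^+ t * beta ^+ u.
    by rewrite exprD mulnC exprM.
  apply: (iffP setUP) => [[]/imsetP[u _ ->]|[u [um|[l ls ->]] ->]].
  - by exists (val u); [left; exact: ltn_ord | exact: E].
  - by exists (i u); [right; exists (val u) => //; exact: ltn_ord | exact: E].
  - by left; apply/imsetP; exists (Ordinal um); rewrite ?E.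
  - by right; apply/imsetP; exists (Ordinal ls); rewrite ?E.
have BP y : reflect (exists2 j, (j < delta - 1)%N & y = beta ^- e * beta ^+ j) (y \in B).
  have E (j : nat) : alpha ^ ((j%:Z - e%:Z) * b%:Z) = beta ^- e * beta ^+ j.
    by rewrite mulrC -exprz_exp expfzDr // exprnN mulrC.
  apply: (iffP imsetP) => [[j _ ->]|[j jd ->]].
    by exists (val j); [rewrite subn1; exact: ltn_ord | exact: E].
  by rewrite subn1 in jd; exists (Ordinal jd); rewrite ?E.
(* The product of the first elements of [A] and [B], so that the exponents in [AB] start at 0. *)
pose a0 := alpha ^+ t * beta ^- e.
have a0_neq0 : a0 != 0 by rewrite mulf_neq0 ?invr_neq0 ?expf_neq0.
(* Adding the interval of length [delta - 1] from [B] to the one of length [m] from [A] gives a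
   single interval of length [N]; each isolated [i l] gives a block of length [delta - 1]. *)
pose N := (m + delta - 2)%N.
pose W := seq.iota 0 N ++ flatten [seq seq.iota (i l) (delta - 1) | l <- seq.iota 0 s].
have [||uW sizeW Wlt] := @uniq_blocks N (delta - 1) s i s_gt0; rewrite -/W.
- by rewrite /N; lia.
- by move=> l ls; have := gap l ls; lia.
have WP w : reflect (exists u j, [/\ J u, (j < delta - 1)%N & w = (u + j)%N]) (w \in W).
  rewrite mem_cat mem_iota; apply: (iffP orP) => [[wN|]|[u [j [[um|[l ls ->]] jd ->]]]].
  - by exists (minn w m.-1), (w - minn w m.-1)%N; split; [left|..]; rewrite /N in wN; lia.
  - case/flatten_mapP => l; rewrite !mem_iota => ls wl.
    by exists (i l), (w - i l)%N; split; [right; exists l|..]; lia.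
  - by left; rewrite /N; lia.
  - right; apply/flatten_mapP; exists l; rewrite ?mem_iota; lia.
(* Since [u + (delta - 2)] is an exponent of [AB], the bound on [W] yields this without proving [i]
   monotone. *)
have Jle u : J u -> (u <= i s.-1)%N.
  move=> Ju; suff /Wlt : (u + (delta - 2))%N \in W by lia.
  by apply/WP; exists u, (delta - 2)%N; split=> //; lia.
have i0_le : (i 0%N <= i s.-1)%N by apply: Jle; right; exists 0%N.
have ABP x : reflect (exists2 w, w \in W & x = a0 * beta ^+ w) (x \in AB).
  have E u j : alpha ^+ t * beta ^+ u * (beta ^- e * beta ^+ j) = a0 * beta ^+ (u + j).
    by rewrite exprD /a0; ring.
  apply: (iffP imset2P) => [[_ _ /AP[u Ju ->] /BP[j jd ->] ->]|[w /WP[u [j [Ju jd ->]]] ->]].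
    by exists (u + j)%N; rewrite ?E //; apply/WP; exists u, j.
  by exists (alpha ^+ t * beta ^+ u) (beta ^- e * beta ^+ j); rewrite ?E //;
    [apply/AP; exists u | apply/BP; exists j].
have cardAB : #|AB| = (N + s * (delta - 1))%N.
  rewrite -sizeW -(size_map (fun w => a0 * beta ^+ w)).
  (* All exponents are below [n - 1], so distinct ones give distinct powers of [beta]. *)
  have /card_uniqP <- : uniq [seq a0 * beta ^+ w | w <- W].
    rewrite map_inj_in_uniq // => w w' /Wlt ww /Wlt ww' /(mulfI a0_neq0)/eqP.
    by rewrite (eq_prim_root_expr prim_beta) !modn_small; [move/eqP | lia..].
  by apply: eq_card => x; apply/ABP/mapP.
have cardAB_le : (#|AB| <= n)%N.
  rewrite cardAB -sizeW -[leqRHS](size_iota 0); apply: uniq_leq_size => // w /Wlt.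
  by rewrite mem_iota; lia.
have kE : k = (n - #|AB|)%N by rewrite cardAB /k /N; lia.
have alpha_n := prim_expr_order prim_alpha; have beta_n := prim_expr_order prim_beta.
have expn1 (x : L) j : x ^+ n = 1 -> (x ^+ j) ^+ n = 1.
  by move=> xn; rewrite exprAC xn expr1n.
have A_unity : {in A, forall x, x ^+ n = 1}.
  by move=> _ /AP[u _ ->]; rewrite exprMn !expn1 // mulr1.
have AB_frob : {in AB, forall z, z ^+ #|K| \in AB}.
  move=> z zAB; have zn : z ^+ n = 1.
    by case/ABP: zAB => w _ ->; rewrite !exprMn exprVn !expn1 // invr1 !mulr1.
  have [j zE] := prim_rootP prim_alpha zn.
  by rewrite zE -exprM cardK; apply: AB_q; rewrite -zE.
have cardC : #|C| = (q ^ k)%N by rewrite (card_cyclic_code_sub iota AB_frob) // cardK kE.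
have delta_le : (delta <= dA)%N.
  rewrite -(ltn_predK delta_gt1).
  (* With this [a] the factor [alpha ^+ t] cancels, and the products with [A] are
     [beta ^+ (u + w).+1] with exponents from 1 to [n - 1], hence never 1. *)
  apply: (dual_code_BCH prim_beta (a := alpha ^- t * beta)).
  - by rewrite mulf_neq0 ?invr_neq0 ?expf_neq0.
  - by lia.
  move=> w _ wd /AP[u /Jle u_le ->].
  have -> : alpha ^+ t * beta ^+ u * (alpha ^- t * beta * beta ^+ w) = beta ^+ (u + w).+1.
    rewrite -addnS exprD exprS mulrACA -!mulrA mulrA divff ?expf_neq0 // mul1r; ring.
  split; first exact: expn1.
  rewrite -[1](expr0 beta) (eq_prim_root_expr prim_beta) !modn_small //; lia.
have lrc : is_LRC C r delta.
  rewrite /r -(ltn_predK delta_gt1).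
  apply: (product_code_LRC iota prim_beta A_unity (a := beta ^- e)).
  - by rewrite invr_neq0 ?expf_neq0.
  - by rewrite -/dA; lia.
  - by apply/set0Pn; exists (alpha ^+ t * beta ^+ 0); apply/AP; exists 0%N => //; left.
  - by move=> w wd; apply/BP; exists w => //; lia.
split=> // ceil_k.
(* The ceiling condition enters here: it permits [s] repair sets in the Singleton-like bound. *)
have sr_lt : (s * r < k)%N.
  have := leq_trunc_div (k + r.-1) r; rewrite -/(ceil_div k r) ceil_k mulSn /r; lia.
have dC : min_dist C = (m + delta - 1)%N.
  (* Substituting [k] in the Singleton-like bound gives exactly [m + delta - 1] from above; the [N]
     consecutive zeros starting at [a0] give [N.+1], the same number, from below. *)
  apply/eqP; rewrite eqn_leq; apply/andP; split.
    have := @LRC_singleton_bound K n C r delta k s (@cyclic_code_subB _ _ iota n AB) lrc.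
    rewrite cardK => /(_ cardC sr_lt); move: kE cardAB cardAB_le; rewrite /N; lia.
  have := @cyclic_code_sub_BCH _ _ iota n AB beta a0 N prim_beta a0_neq0.
  have -> : (m + delta - 1)%N = N.+1 by rewrite /N; lia.
  apply; first by rewrite cardAB in cardAB_le; lia.
  by move=> w wN; apply/ABP; exists w => //; rewrite mem_cat mem_iota wN.
split=> //; split=> //; exists k; split; first by rewrite cardK.
rewrite dC ceil_k; move: kE cardAB cardAB_le; rewrite /N; lia.
Qed.
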